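(* Let $X$ be a non-void, regular, first countable, $T_1$-space. If $X$ is meager (in itself), then $X$ contains a countable perfect set that is homeomorphic to the space $\mathbb{Q}$ of rational numbers.
   Context: A subset of a space $X$ is a perfect set if it is non-void, closed in $X$, and has no isolated points as a subspace of $X$. $X$ is meager if it is a countable union of subsets whose closures have empty interior. $\mathbb{Q}$ carries its usual topology as a subspace of $\mathbb{R}$. *)

(* Defs.v *)
(* MathComp-Analysis *)
From mathcomp Require Import all_boot all_order all_algebra.
From mathcomp Require Import all_classical all_reals topology normedtype.

Set Implicit Arguments.
Unset Strict Implicit.
Unset Printing Implicit Defensive.

Local Open Scope classical_set_scope.

Definition first_countable (T : topologicalType) :=
  forall x : T, exists2 B : set (set T),
    countable B & B `<=` nbhs x /\ filter_from B id --> x.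

(* The index type [nat] also covers finite unions: repeat [set0]. *)
Definition meager (T : topologicalType) (A : set T) :=
  exists F : nat -> set T,
    (forall n, interior (closure (F n)) = set0) /\ A = \bigcup_n F n.

(* Unlike the library's [perfect_set], this excludes the empty set. *)
Definition nonempty_perfect_set (T : topologicalType) (A : set T) :=
  [/\ A !=set0, closed A & isolated A = set0].

Definition homeomorphic (S T : topologicalType) :=
  exists (f : S -> T) (g : T -> S),
    [/\ cancel f g, cancel g f, continuous f & continuous g].

(* Main.v *)
Require Import Defs.
From mathcomp Require Import all_boot all_order all_algebra.
From mathcomp Require Import all_classical all_reals topology normedtype.
From mathcomp Require Import lra.

(** The finite sequences of natural numbers form a tree in which [n :: s] is
the [n]-th child of [s].  Attach to every node [s] an open set [U s] and a point
[x s] of [U s] so that the sets of the children are disjoint subsets of the set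
of [s], stay away from [x s] one by one, but shrink to [x s] as a sequence
([scheme]).  The traces of the sets [U s] on the range of [x] then determine its
topology: the points of the cones above all but finitely many children of [s],
together with [x s], form the basic neighbourhoods of [x s].  This description
mentions neither the points nor the ambient space, so the ranges of any two
schemes are homeomorphic ([scheme_homeomorphic]), and none of them has an
isolated point ([scheme_perfect]).  It is enough to build one scheme whose range
is the set of rational numbers and one in [X] whose range is closed.

In the real line, cut [U s] into the annuli around [x s] with radii [e / n] for
a small irrational [e]: no rational lies on a boundary, so only [x s] itself is
lost ([splits_rational]).  Taking for [x s] the first rational of [U s] in an
enumeration ensures that every rational is reached after finitely many cuts
([rational_scheme]).

In [X], write the space as a union of nowhere dense sets [F k].  Points outside
the closure of [F k] accumulate at every point, so first countability and
regularity provide the children of a node of depth [k] with sets whose closures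
miss the closure of [F k] ([splits_avoiding]).  A point adherent to the range
but outside it would lie in the closures of the sets along an infinite branch,
hence outside every [F k], which is impossible ([scheme_closed]). *)

Import Order.TTheory GRing.Theory Num.Theory.
Import numFieldNormedType.Exports.

Set Implicit Arguments.
Unset Strict Implicit.

Local Open Scope classical_set_scope.

(** * Schemes of open sets *)

Record splits (T : topologicalType) (x : T) (U : set T) (V : nat -> set T) :
    Prop := Splits {
  splits_sub : forall n, V n `<=` U;
  splits_far : forall n, ~ closure (V n) x;
  splits_disjoint : forall m n z, V m z -> V n z -> m = n;
  splits_shrink : forall W, nbhs x W ->
    exists m, forall n, (m <= n)%N -> V n `<=` W }.

Record scheme (T : topologicalType) (U : seq nat -> set T) (x : seq nat -> T) :
    Prop := Scheme {
  scheme_open : forall s, open (U s);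
  scheme_mem : forall s, U s (x s);
  scheme_splits : forall s, splits (x s) (U s) (fun n => U (n :: s)) }.

(** Dependent choice along the tree: a family of sets is obtained as soon as
every nonempty open set can be split; the number [k] passed to [Q] is the depth
of the node, which lets the splitting meet a different constraint at each
level. *)
Lemma tree_exists (T : topologicalType)
    (Q : nat -> set T -> (nat -> set T) -> Prop) :
  [set: T] !=set0 ->
  (forall k U, open U -> U !=set0 ->
     exists2 V, forall n, open (V n) /\ V n !=set0 & Q k U V) ->
  exists U : seq nat -> set T,
    [/\ U [::] = setT, forall s, open (U s) /\ U s !=set0
      & forall s, Q (size s) (U s) (fun n => U (n :: s))].
Proof.
move=> T0 step.
have /choice[V HV] : forall kU : nat * set T, exists V : nat -> set T,
    open kU.2 -> kU.2 !=set0 ->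
    (forall n, open (V n) /\ V n !=set0) /\ Q kU.1 kU.2 V.
  move=> [k U]; have [[oU U0]|nU] := pselect (open U /\ U !=set0).
    by have [V ? ?] := step k U oU U0; exists V.
  by exists (fun=> setT) => oU U0; case: nU.
pose U := fix U (s : seq nat) :=
  if s is n :: s' then V (size s', U s') n else setT.
have UP s : open (U s) /\ U s !=set0.
  elim: s => [|n s [oU U0]]; first by split=> //; exact: openT.
  by have [/(_ n)] := HV (size s, U s) oU U0.
exists U; split=> // s; have [oU U0] := UP s.
by have [_] := HV (size s, U s) oU U0.
Qed.

(** * The range of a scheme *)

Section scheme_theory.
Variables (T : topologicalType) (U : seq nat -> set T) (x : seq nat -> T).
Hypothesis Ux : scheme U x.

Lemma scheme_sub s t : U (t ++ s) `<=` U s.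
Proof.
elim: t => [//|n t IH] /=; apply: subset_trans IH.
exact: (splits_sub (scheme_splits Ux (t ++ s)) (n := n)).
Qed.

Lemma scheme_cone_mem s t : U s (x (t ++ s)).
Proof. exact/scheme_sub/(scheme_mem Ux). Qed.

Lemma scheme_child_neq n s t : x (t ++ n :: s) <> x s.
Proof.
move=> e; apply: (splits_far (scheme_splits Ux s) (n := n)).
by apply: subset_closure; rewrite -e; exact: scheme_cone_mem.
Qed.

(** Disjointness of siblings lets the point [x t] decide, digit by digit, the
end of [t]; if [t] ran out before [s] does, then [x t] would belong to the set
of one of its own children. *)
Lemma scheme_coneP s t : U s (x t) -> exists u, t = u ++ s.
Proof.
elim: s => [|n s IH] Ust; first by exists t; rewrite cats0.
have [u tE] := IH (@scheme_sub s [:: n] _ Ust).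
case/lastP: u tE => [|u m] tE.
  exfalso; apply: (splits_far (scheme_splits Ux s) (n := n)).
  by apply: subset_closure; rewrite -[s in x s]/([::] ++ s) -tE.
exists u; rewrite tE cat_rcons; congr (_ ++ _ :: _).
rewrite tE cat_rcons in Ust.
exact: (splits_disjoint (scheme_splits Ux s) (scheme_cone_mem _ _) Ust).
Qed.

Lemma scheme_inj : injective x.
Proof.
move=> s t e.
have [u tE] : exists u, t = u ++ s.
  by apply: scheme_coneP; rewrite -e; exact: (scheme_mem Ux).
case/lastP: u tE => [//|u n]; rewrite cat_rcons => tE.
by exfalso; apply: (@scheme_child_neq n s u); rewrite -tE.
Qed.

(** Half of the description of the topology of the range: removing from [U s]
the closures of the first [m] children leaves a neighbourhood of [x s].  The
other half is [scheme_cone_shrink]. *)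
Lemma scheme_nbhs s m : exists2 W, nbhs (x s) W & forall t, W (x t) ->
  t = s \/ exists2 n, (m <= n)%N & exists u, t = u ++ n :: s.
Proof.
exists (U s `&` [set z | forall i : 'I_m, ~ closure (U ((i : nat) :: s)) z]).
  apply: filterI.
    by apply: open_nbhs_nbhs; split;
      [exact: (scheme_open Ux)|exact: (scheme_mem Ux)].
  apply: filter_forall => i; apply: open_nbhs_nbhs; split.
    exact/closed_openC/closed_closure.
  exact: (splits_far (scheme_splits Ux s)).
move=> t [/scheme_coneP[u ->]]; case/lastP: u => [|u n] W; first by left.
rewrite cat_rcons in W *; right; exists n; last by exists u.
rewrite leqNgt; apply/negP => nm.
by apply: (W (Ordinal nm)); apply: subset_closure; exact: scheme_cone_mem.
Qed.

Lemma scheme_cone_shrink s W : nbhs (x s) W ->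
  exists m, forall n u, (m <= n)%N -> W (x (u ++ n :: s)).
Proof.
move=> /(splits_shrink (scheme_splits Ux s))[m Wm].
by exists m => n u mn; apply: (Wm n mn); exact: scheme_cone_mem.
Qed.

Lemma scheme_perfect : isolated (range x) = set0.
Proof.
rewrite -subset0 => y [/set_mem[s _ <-{y}] [W + WE]].
move=> /scheme_cone_shrink[m /(_ m [::] (leqnn m)) /= Wm].
have : [set x s] (x (m :: s)) by rewrite -WE; split=> //; exists (m :: s).
by move=> /=; exact: (@scheme_child_neq m s [::]).
Qed.

End scheme_theory.

(** Basic neighbourhoods of [x s] and of [y s] are given by the same sets of
indices, so a map that preserves the indices is continuous. *)
Lemma scheme_continuous (S T : topologicalType) U (x : seq nat -> S)
    V (y : seq nat -> T) (f : set_type (range x) -> set_type (range y)) :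
  scheme U x -> scheme V y ->
  (forall p s, set_val p = x s -> set_val (f p) = y s) -> continuous f.
Proof.
move=> Ux Vy fE; apply: continuous_comp_initial => p W /=.
have [s _ sp] := set_valP p.
rewrite (fE p s)// => ysW; have [m Wm] := scheme_cone_shrink Vy ysW.
have [N + NP] := scheme_nbhs Ux s m; rewrite sp => /initial_continuous Np.
have {}Np : nbhs p (set_val @^-1` N) by [].
rewrite nbhs_simpl; apply: filterS Np => q /= Nq; have [t _ tq] := set_valP q.
rewrite (fE q t)//; have [|->|[n mn [u ->]]] := NP t.
- by rewrite tq.
- exact: nbhs_singleton.
- exact: Wm.
Qed.

Lemma scheme_homeomorphic (S T : topologicalType) U (x : seq nat -> S)
    V (y : seq nat -> T) :
  scheme U x -> scheme V y ->
  homeomorphic (set_type (range x)) (set_type (range y)).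
Proof.
move=> Ux Vy.
(* [tr] sends the point of index [s] to the point of index [s]. *)
have idx (Z : Type) (z : seq nat -> Z) (p : set_type (range z)) :
  {s | set_val p = z s}.
  by apply: cid; have [s _ ps] := set_valP p; exists s.
pose tr (Y Z : topologicalType) (y' : seq nat -> Y) (z : seq nat -> Z)
  (p : set_type (range y')) : set_type (range z) :=
  SigSub (mem_set (ex_intro2 _ _ (sval (idx _ _ p)) I erefl)).
have trE (Y Z : topologicalType) W (y' : seq nat -> Y) (z : seq nat -> Z) :
    scheme W y' ->
    forall p s, set_val p = y' s -> set_val (tr Y Z y' z p) = z s.
  move=> Wy p s ps; congr (z _).
  by apply: (scheme_inj Wy); rewrite -(svalP (idx _ _ p)).
exists (tr _ _ x y), (tr _ _ y x); split.
- move=> p; apply: val_inj; have [s ps] := idx _ _ p.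
  by apply: etrans (esym ps); apply: (trE _ _ _ _ _ Vy);
    exact: (trE _ _ _ _ _ Ux _ _ ps).
- move=> p; apply: val_inj; have [s ps] := idx _ _ p.
  by apply: etrans (esym ps); apply: (trE _ _ _ _ _ Ux);
    exact: (trE _ _ _ _ _ Vy _ _ ps).
- exact: (scheme_continuous Ux Vy (trE _ _ _ _ _ Ux)).
- exact: (scheme_continuous Vy Ux (trE _ _ _ _ _ Vy)).
Qed.

(** Suppose that [y] is adherent to the range but not in it.  If [y] is adherent
to the cone of [s], a closed neighbourhood of [x s] that omits [y] contains the
cones of all but finitely many children, so [y] is adherent to the cone of one
of the others.  Hence [y] follows a branch of the tree, and it cannot belong to
any [F k]. *)
Lemma scheme_closed (T : topologicalType) (F : nat -> set T) U
    (x : seq nat -> T) :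
  regular_space T -> accessible_space T -> [set: T] = \bigcup_n F n ->
  scheme U x ->
  (forall s n, closure (U (n :: s)) `<=` ~` closure (F (size s))) ->
  closed (range x).
Proof.
move=> regT T1 cover Ux UF y cly; apply: contrapT => ny.
pose cone s := range (fun t => x (t ++ s)).
have branch j : exists2 s, size s = j & closure (cone s) y.
  elim: j => [|j [s <- ys]].
    exists [::] => //; apply: closure_subset cly => _ [t _ <-].
    by exists t => //; rewrite cats0.
  have : nbhs (x s) (~` [set y]).
    apply: open_nbhs_nbhs; split; last by move=> xy; apply: ny; exists s.
    exact/closed_openC/accessible_closed_set1.
  move=> /regT[B Bs By]; have [m Bm] := scheme_cone_shrink Ux Bs.
  pose C := \bigcup_(n in `I_m) closure (cone (n :: s)).
  have : closed (closure B `|` C).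
    apply: closedU; first exact: closed_closure.
    by apply: closed_bigcup => // n _; exact: closed_closure.
  move=> /(_ y) [|yB|[n _ yn]]; last by exists (n :: s).
  - apply: closure_subset ys => _ [t _ <-]; case/lastP: t => [|t n].
      by left; apply: subset_closure; exact: nbhs_singleton.
    rewrite cat_rcons; have [mn|nm] := leqP m n.
      by left; apply: subset_closure; exact: Bm.
    by right; exists n => //; apply: subset_closure; exists t.
  - by case: (By _ yB).
have [k _ Fky] : (\bigcup_n F n) y by rewrite -cover.
have [[//|n s] [sk] ys] := branch k.+1.
apply: (UF s n y); last by rewrite sk; exact: subset_closure.
by apply: closure_subset ys => _ [t _ <-]; exact: (scheme_cone_mem Ux).
Qed.

(** * Splitting in a first countable regular space *)

Lemma countable_nbhs_base (T : topologicalType) (x : T) :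
  first_countable T -> exists G : nat -> set T,
    (forall n, nbhs x (G n)) /\ (forall W, nbhs x W -> exists n, G n `<=` W).
Proof.
move=> /(_ x)[B /countable_injP[f f_inj] [Bx xB]].
have /choice[G GP] n : exists A, nbhs x A /\ forall b, B b -> f b = n -> A = b.
  have [[b Bb <-]|nb] := pselect (exists2 b, B b & f b = n).
    exists b; split=> [|c Bc cb]; first exact: Bx.
    by apply: f_inj; rewrite ?inE.
  (* Numbers that code no member of the base are sent to the whole space. *)
  exists setT; split; first exact: filterT.
  by move=> b Bb bn; case: nb; exists b.
exists G; split=> [n|W /xB[b Bb bW]]; first by have [] := GP n.
by exists (f b); have [_ /(_ b Bb erefl) ->] := GP (f b).
Qed.

(** The pieces are cut off one at a time: with [W n] the open neighbourhood of
[x] that is left, regularity gives a piece inside [W n], away from [x] and from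
[D], and the next neighbourhood omits the closure of this piece.  Intersecting
with a countable base at [x] makes the remainders, hence the pieces, shrink to
[x]. *)
Lemma splits_avoiding (T : topologicalType) (D U : set T) (x : T) :
  regular_space T -> first_countable T -> accessible_space T ->
  closed D -> open U -> U x ->
  (forall W, open W -> W x -> exists2 y, W y & y <> x /\ ~ D y) ->
  exists2 V, forall n, open (V n) /\ V n !=set0 &
    splits x U V /\ forall n, closure (V n) `<=` ~` D.
Proof.
move=> regT fcT T1 cD oU Ux acc; have [G [Gx GP]] := countable_nbhs_base x fcT.
have /choice[next nextP] W : exists V, open W -> W x ->
    [/\ open V, V !=set0, closure V `<=` W, ~ closure V x
      & closure V `<=` ~` D].
  have [[oW Wx]|nW] := pselect (open W /\ W x); last first.
    by exists setT => oW Wx; case: nW.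
  have [y Wy [yx Dy]] := acc W oW Wx.
  have : nbhs y (W `&` ~` [set x] `&` ~` D).
    apply: open_nbhs_nbhs; split; last by split.
    apply: openI; last exact: closed_openC.
    by apply: openI => //; exact/closed_openC/accessible_closed_set1.
  move=> /regT[C Cy CP]; exists (interior C) => _ _.
  have {}CP : closure (interior C) `<=` W `&` ~` [set x] `&` ~` D.
    by apply: subset_trans CP; apply: closure_subset; exact: interior_subset.
  split; first exact: open_interior.
  - by exists y.
  - by move=> z /CP[[]].
  - by move=> /CP[[_ nx] _]; exact: nx.
  - by move=> z /CP[].
pose W := fix W n := if n is n'.+1 then
  W n' `&` interior (G n') `&` ~` closure (next (W n')) else U.
have WP n : open (W n) /\ W n x.
  elim: n => [//|n [oW Wx]]; have [_ _ _ nx _] := nextP _ oW Wx.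
  split; last by split=> //; split=> //; exact: Gx.
  apply: openI; last exact/closed_openC/closed_closure.
  by apply: openI => //; exact: open_interior.
have {}nextP n : [/\ open (next (W n)), next (W n) !=set0,
    closure (next (W n)) `<=` W n, ~ closure (next (W n)) x
    & closure (next (W n)) `<=` ~` D].
  by have [oW Wx] := WP n; exact: nextP.
have nextW n : next (W n) `<=` W n.
  by move=> z /subset_closure; have [_ _ + _ _] := nextP n; exact.
have Wdec m n : (m <= n)%N -> W n `<=` W m.
  move=> /subnK <-; elim: (n - m)%N => [//|j IH].
  by apply: subset_trans IH => z [[]].
have disj m n z : (m < n)%N -> next (W m) z -> next (W n) z -> False.
  by move=> mn mz /nextW /(Wdec _ _ mn)[_]; apply; exact: subset_closure.
exists (fun n => next (W n)); first by move=> n; have [] := nextP n.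
split; last by move=> n; have [] := nextP n.
split.
- by move=> n; apply: subset_trans (@Wdec 0 n _); [exact: nextW|].
- by move=> n; have [] := nextP n.
- by move=> m n z mz nz; case: (ltngtP m n) => // /disj; move=> /(_ z); case.
- move=> N /GP[m Gm]; exists m.+1 => n mn z /nextW /(Wdec _ _ mn)[[_ + _]].
  by move=> /interior_subset /Gm.
Qed.

(** A second nowhere dense set, one that contains [x], serves to avoid [x]; in
particular a meager space has no isolated point. *)
Lemma meager_escape (T : topologicalType) (F : nat -> set T) :
  (forall n, interior (closure (F n)) = set0) -> [set: T] = \bigcup_n F n ->
  forall k x W, open W -> W !=set0 ->
  exists2 y, W y & y <> x /\ ~ closure (F k) y.
Proof.
move=> F0 cover k x W oW W0.
have escape j (A : set T) :
    open A -> A !=set0 -> exists2 y, A y & ~ closure (F j) y.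
  move=> oA [a Aa]; apply: contrapT => H.
  suff : interior (closure (F j)) a by rewrite F0.
  apply: (filterS _ (open_nbhs_nbhs (conj oA Aa))) => z Az.
  by apply: contrapT => nz; apply: H; exists z.
have [j _ Fjx] : (\bigcup_n F n) x by rewrite -cover.
have [a Wa Fka] := escape k W oW W0.
have [|b [Wb Fkb] Fjb] := escape j (W `&` ~` closure (F k)) _
  (ex_intro _ a (conj Wa Fka)).
  by apply: openI => //; exact/closed_openC/closed_closure.
exists b => //; split=> // bx; apply: Fjb; rewrite bx; exact: subset_closure.
Qed.

(** * The rational numbers as the range of a scheme *)

Local Open Scope ring_scope.

Lemma countable_image (S T : Type) (f : S -> T) (A : set S) :
  countable A -> countable (f @` A).
Proof. exact/card_le_trans/card_image_le. Qed.

Lemma sqrt2_irrational (R : realType) : ~ rational (Num.sqrt 2 : R).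
Proof.
move=> /rationalP[a [b sE]].
have s2 : (Num.sqrt 2 : R) ^+ 2 = 2 by rewrite sqr_sqrtr.
have b0 : b%:R != 0 :> R.
  by apply/eqP => b0; move: s2; rewrite sE b0 invr0 mulr0 expr0n /=; lra.
have ab : a ^+ 2 = 2 * b%:Z ^+ 2.
  apply/eqP; rewrite -(eqr_int R) intrM !rmorphXn /=; apply/eqP.
  by rewrite -[2%:~R]s2 sE expr_div_n divfK// expf_neq0.
have : (`|a| ^ 2 = 2 * b ^ 2)%N by rewrite -abszX ab abszM abszX.
have b1 : (0 < b)%N by rewrite -(ltr_nat R) lt0r b0 ler0n.
(* The exponent of 2 is even on the left and odd on the right. *)
move=> /(congr1 (odd \o logn 2)) /=.
by rewrite lognM ?expn_gt0 ?b1// !lognX (@logn_prime 2 2)// oddD !oddM.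
Qed.

Lemma small_irrational (R : realType) (d : R) :
  0 < d -> exists2 e, 0 < e < d & ~ rational e.
Proof.
move=> d0; have [|q] := @rat_in_itvoo R 0 (d / 2); first by lra.
rewrite in_itv /= => /andP[q0 qd].
have s2 : (Num.sqrt 2 : R) ^+ 2 = 2 by rewrite sqr_sqrtr.
have s0 : 0 < (Num.sqrt 2 : R) by rewrite sqrtr_gt0.
exists (Num.sqrt 2 * ratr q); first by apply/andP; split; nra.
move=> [r _ rE]; apply: (@sqrt2_irrational R); exists (r / q) => //.
by rewrite fmorph_div /= rE mulfK// gt_eqF.
Qed.

(** The [n]-th piece is the part of [U] at distance between [e / n.+1] and
[e / n] from [x]; the inequalities are multiplied out so that they make sense
for [n = 0], where there is no upper bound.  A rational of [U] other than [x] is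
in one of the pieces because [e] is not a multiple of its distance to [x]. *)
Lemma splits_rational (R : realType) (U : set R) (x : R) :
  rational x -> open U -> U x ->
  exists2 V, forall n, open (V n) /\ V n !=set0 &
    splits x U V /\
    forall q, rational q -> U q -> q = x \/ exists n, V n q.
Proof.
move=> xQ oU Ux.
have [d /= d0 dU] : nbhs_ball x U by apply/nbhs_ballP; exact: open_nbhs_nbhs.
have [|e /andP[e0 ed] eQ] := @small_irrational R (d / 2); first by lra.
have cdist (k : R) : continuous (fun y => k * `|y - x|).
  move=> y; apply: cvgMr; apply: cvg_norm; apply: cvgB; first exact: cvg_id.
  exact: cvg_cst.
(* As [2 * e < d], each annulus meets [ball x d], even for [n = 0], where the
   point chosen below is at distance [2 * e]. *)
pose V n := U `&` [set y | n%:R * `|y - x| < e]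
              `&` [set y | e < n.+1%:R * `|y - x|].
have index_le m n y : V m y -> V n y -> (m <= n)%N.
  move=> [[_ /= em] _] [_ /= en]; rewrite leqNgt; apply/negP => nm.
  suff : n.+1%:R * `|y - x| <= m%:R * `|y - x| by lra.
  by rewrite ler_wpM2r// ler_nat.
have VP n : open (V n) /\ V n !=set0.
  split.
    apply: openI; first apply: openI => //.
      by exact: ((continuousP _).1 (cdist n%:R) _ (@open_lt _ e)).
    by exact: ((continuousP _).1 (cdist n.+1%:R) _ (@open_gt _ e)).
  have n0 : (0 : R) <= n%:R by [].
  (* [t] solves [t * (n + 1/2) = e], midway between the two conditions. *)
  pose t := e / (n%:R + 1 / 2).
  have c0 : 0 < (n%:R : R) + 1 / 2 by lra.
  have te : t * n%:R + t / 2 = e.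
    by rewrite -[RHS](divfK (lt0r_neq0 c0)) -/t mulrDr mulrA mulr1.
  have t0 : 0 < t by rewrite divr_gt0.
  have xt : `|x + t - x| = t by rewrite addrC addKr gtr0_norm.
  exists (x + t); split; [split|]; rewrite /= ?xt.
  - by apply: dU; rewrite /ball /= distrC xt; nra.
  - by lra.
  - by rewrite -natr1; lra.
exists V => //; split; first split.
- by move=> n y [[]].
- move=> n; apply/existsNP.
  have xe : nbhs x [set y | n.+1%:R * `|y - x| < e].
    apply: open_nbhs_nbhs; split; last by rewrite /= subrr normr0 mulr0.
    by exact: ((continuousP _).1 (cdist n.+1%:R) _ (@open_lt _ e)).
  exists [set y | n.+1%:R * `|y - x| < e] => /(_ xe) [y [[_ /= ye] /=]].
  by rewrite ltNge ltW.
- move=> m n y Vm Vn; apply/eqP.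
  by rewrite eqn_leq (index_le m n y)// (index_le n m y).
- move=> W /nbhs_ballP[r /= r0 rW]; exists (Num.truncn (e / r)).+1.
  move=> n; rewrite -(ler_nat R) => mn y [[_ /= yn] _]; apply: rW.
  rewrite /ball /= distrC ltNge; apply/negP => ry.
  have : e / r < n%:R by apply: lt_le_trans mn; exact: truncnS_gt.
  by rewrite ltr_pdivrMr// => en; nra.
move=> q qQ Uq; have [->|qx] := eqVneq q x; [by left|right].
have qx0 : 0 < `|q - x| by rewrite normr_gt0 subr_eq0.
have /truncn_itv/andP[+ te] : 0 <= e / `|q - x| by rewrite divr_ge0// ltW.
rewrite le_eqVlt => /predU1P[eE|et]; last first.
  exists (Num.truncn (e / `|q - x|)); split; [split=> //|].
    by rewrite /= -ltr_pdivlMr.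
  by rewrite /= -ltr_pdivrMr.
exfalso; apply: eQ; move: xQ qQ => [x' _ x'E] [q' _ q'E].
exists ((Num.truncn (e / `|q - x|))%:R * `|q' - x'|) => //.
by rewrite rmorphM /= ratr_nat ratr_norm rmorphB /= x'E q'E eE divfK// gt_eqF.
Qed.

Lemma least_rational (R : realType) :
  exists (code : R -> nat) (pt : set R -> R),
  forall U, open U -> U !=set0 ->
  [/\ rational (pt U), U (pt U) & forall q, rational q -> U q -> q <> pt U ->
     (code (pt U) < code q)%N].
Proof.
have /countable_injP[code code_inj] : countable (@rational R).
  by apply: countable_image; exact: countableP.
suff /choice[pt ptP] : forall U : set R, exists p, open U -> U !=set0 ->
    [/\ rational p, U p & forall q, rational q -> U q -> q <> p ->
     (code p < code q)%N] by exists code, pt.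
move=> U; have [[oU U0]|nU] := pselect (open U /\ U !=set0); last first.
  by exists 0 => oU U0; case: nU.
have [q [Uq qQ]] := @dense_rat R U U0 oU.
have ex : exists n, `[< exists2 p, rational p /\ U p & code p = n >].
  by exists (code q); apply/asboolP; exists q.
have [n /asboolP[p [pQ Up] <-] nmin] := ex_minnP ex.
exists p => _ _; split=> // r rQ Ur rp.
rewrite ltn_neqAle nmin ?andbT; last by apply/asboolP; exists r.
by apply/eqP => /code_inj pr; apply: rp; rewrite pr ?inE.
Qed.

(** The code of the least rational of a set increases strictly along a branch,
so a rational [q] that is never chosen cannot stay in the sets of a branch
beyond depth [code q]; yet it is in a set of every depth, as the chosen point is
the only rational that a splitting loses. *)
Lemma rational_scheme (R : realType) :
  exists U (x : seq nat -> R), scheme U x /\ range x = rational.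
Proof.
have [code [pt ptP]] := least_rational R.
have [|k U oU U0|U [U0 oU UP]] := @tree_exists R (fun _ U V =>
  splits (pt U) U V /\
  forall q, rational q -> U q -> q = pt U \/ exists n, V n q).
- by exists 0.
- by have [? ? _] := ptP U oU U0; exact: splits_rational.
have {}ptP s : [/\ rational (pt (U s)), U s (pt (U s)) &
    forall q, rational q -> U s q -> q <> pt (U s) ->
      (code (pt (U s)) < code q)%N].
  by have [? ?] := oU s; exact: ptP.
have Ux : scheme U (fun s => pt (U s)).
  split=> s; first by have [] := oU s.
    by have [] := ptP s.
  by have [] := UP s.
exists U, (fun s => pt (U s)); split=> //.
apply/seteqP; split=> [_ [s _ <-]|q qQ]; first by have [] := ptP s.
apply: contrapT => nq.
have {}nq s : q <> pt (U s) by move=> qs; apply: nq; exists s.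
have size_code s : (size s <= code (pt (U s)))%N.
  elim: s => [//|n s IH]; apply: leq_ltn_trans IH _.
  have [_ _] := ptP s; apply; first by have [] := ptP (n :: s).
    exact: (scheme_cone_mem Ux s [:: n]).
  exact: (scheme_child_neq (n := n) (s := s) (t := [::]) Ux).
have branch j : exists2 s, size s = j & U s q.
  elim: j => [|j [s <- Us]]; first by exists [::]; rewrite ?U0.
  have [_ /(_ q qQ Us)[//|[n]]] := UP s; first by move=> /nq.
  by exists (n :: s).
have [s sE Us] := branch (code q).
have [_ _ /(_ q qQ Us (nq s))] := ptP s.
by rewrite ltnNge -sE size_code.
Qed.

(** * Meager spaces *)

Unset Implicit Arguments.
Local Close Scope ring_scope.

(* [set_type A] carries the subspace topology; [@rational R] is the set of
   rational numbers inside the real line [R]. *)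
Theorem theorem4p2p5 (R : realType) (X : topologicalType)
    (X_nonempty : [set: X] !=set0)
    (X_regular : regular_space X)
    (X_first_countable : first_countable X)
    (X_T1 : accessible_space X)
    (X_meager : meager [set: X]) :
  exists P : set X,
    [/\ countable P, nonempty_perfect_set P
      & homeomorphic (set_type P) (set_type (@rational R))].
Proof.
have [F [F0 cover]] := X_meager; have [x0 _] := X_nonempty.
pose pt (U : set X) := xget x0 U.
have ptP U : U !=set0 -> U (pt U).
  by move=> [y Uy]; exact: (xgetPex _ (ex_intro _ y Uy)).
have [//|k U oU U0|U [_ oU UP]] := @tree_exists X (fun k U V =>
  splits (pt U) U V /\ forall n, closure (V n) `<=` ~` closure (F k)).
  apply: splits_avoiding => //; [exact: closed_closure|exact: ptP|].
  by move=> W oW Wx; apply: meager_escape => //; exists (pt U).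
have Ux : scheme U (fun s => pt (U s)).
  split=> s; first by have [] := oU s.
    by have [_ /ptP] := oU s.
  by have [] := UP s.
exists (range (fun s => pt (U s))); split.
- by apply: countable_image; exact: countableP.
- split; first by exists (pt (U [::])); exists [::].
    by apply: (scheme_closed X_regular X_T1 cover Ux) => s; have [] := UP s.
  exact: scheme_perfect Ux.
- have [V [y [Vy <-]]] := rational_scheme R.
  exact: scheme_homeomorphic Ux Vy.
Qed.
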